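(* For every integer $n\ge 2$: for each $r\in\{1,2,3,\dots,p_{n+1}-1\}$ the numbers $r\,p_n\#-1$ and $r\,p_n\#+1$ are records of $f_3$; furthermore, $$f_3(k+p_n\#)=f_3(k)+p_n\#$$ for every integer $k\in[p_{n+1},\,(p_{n+1}-1)\,p_n\#]$.
   Context: $\mathbb N=\{1,2,3,\dots\}$. $p_n$ denotes the $n$-th prime ($p_1=2$) and $p_n\#=\prod_{k=1}^n p_k$ is the $n$-th primorial number. The function $f_3:\mathbb N\to\mathbb N$ is defined recursively by $f_3(1)=1$, $f_3(2)=3$, and, for each $n\ge 3$, $f_3(n)$ is the smallest positive integer that is not in $\{f_3(1),\dots,f_3(n-1)\}$ and is coprime with $f_3(n-1)$. A turning point of $f_3$ is a natural number $t$ such that either (i) $t>3$ and $f_3(t)-f_3(t-1)>1$, or (ii) $t=3$ and $f_3(3)\neq\min(\mathbb N\setminus\{1,3\})$ (since $f_3(3)=2$, case (ii) does not occur). A record of $f_3$ is a value $f_3(t)$ where $t$ is a turning point of $f_3$. *)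

(* Defs.v *)
From mathcomp Require Import all_boot.

Set Implicit Arguments.
Unset Strict Implicit.
Unset Printing Implicit Defensive.

(* The positive integers are represented by [nat]; sequences indexed from 1
   take an irrelevant value at index 0. *)

Definition is_least (P : pred nat) (m : nat) : Prop :=
  P m /\ forall k, P k -> m <= k.

Lemma next_prime_ex (m : nat) : exists p, (m < p) && prime p.
Proof. by have [p lt_mp p_pr] := prime_above m; exists p; rewrite lt_mp. Qed.

Definition next_prime (m : nat) : nat := ex_minn (next_prime_ex m).

Definition nth_prime (n : nat) : nat := iter n next_prime 0.

Definition primorial (n : nat) : nat := \prod_(1 <= k < n.+1) nth_prime k.

Definition admissible (s : seq nat) (a : nat) : pred nat :=
  [pred m | [&& 0 < m, m \notin s & coprime m a]].

Lemma admissible_ex (s : seq nat) (a : nat) : exists m, admissible s a.+1 m.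
Proof.
exists (a.+1 * sumn s).+1; apply/and3P; split=> //.
  apply/negP=> /(nth_index 0) Es.
  have: nth 0 s (index (a.+1 * sumn s).+1 s) <= sumn s.
    elim: s (index _ s) {Es} => [|x s IHs] [|i] //=; first exact: leq_addr.
    exact: leq_trans (IHs i) (leq_addl _ _).
  rewrite Es ltnNge => /negP; apply; first exact: leq_pmull.
by rewrite coprime_sym /coprime -[X in gcdn _ X]addn1 mulnC gcdnMDl gcdn1.
Qed.

(* The zero case is never reached from [f3_values]; see [f3_rec]. *)
Definition greedy_next (s : seq nat) (a : nat) : nat :=
  if a is a'.+1 then ex_minn (admissible_ex s a') else 1.

(* [f3_values n] is [:: f3 n; ...; f3 2; f3 1]. *)
Fixpoint f3_values (n : nat) : seq nat :=
  match n with
  | 0 => [::]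
  | 1 => [:: 1]
  | 2 => [:: 3; 1]
  | n'.+1 => let s := f3_values n' in greedy_next s (head 0 s) :: s
  end.

Definition f3 (n : nat) : nat := head 0 (f3_values n).

Lemma f3_1 : f3 1 = 1. Proof. by []. Qed.
Lemma f3_2 : f3 2 = 3. Proof. by []. Qed.

Lemma f3_valuesE (n : nat) : f3_values n = rev [seq f3 k | k <- iota 1 n].
Proof.
elim: n => // n IHn; rewrite -{2}addn1 iotaD map_cat rev_cat -IHn /= add1n.
by case: n IHn => [|[|n]].
Qed.

Lemma f3_gt0 (n : nat) : 0 < n -> 0 < f3 n.
Proof.
case: n => [|[|[|n]]] // _.
have ->: f3 n.+3 = greedy_next (f3_values n.+2) (f3 n.+2) by [].
by case: (f3 n.+2) => // a; rewrite /greedy_next; case: ex_minnP => m /and3P[].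
Qed.

Lemma f3_rec (n : nat) : 3 <= n ->
  is_least (admissible [seq f3 k | k <- iota 1 n.-1] (f3 n.-1)) (f3 n).
Proof.
case: n => [|[|[|n]]] // _; rewrite [n.+3.-1]/=.
have Ef: f3 n.+3 = greedy_next (f3_values n.+2) (f3 n.+2) by [].
have := @f3_gt0 n.+2 isT; rewrite Ef; case: (f3 n.+2) => // a _.
rewrite /greedy_next; case: ex_minnP => m /and3P[m_gt0 m_new m_co] m_min.
have memE k: (k \in f3_values n.+2) = (k \in [seq f3 i | i <- iota 1 n.+2]).
  by rewrite f3_valuesE mem_rev.
split=> [|k /and3P[k_gt0 k_new k_co]].
  by apply/and3P; split; rewrite // -memE.
by apply: m_min; apply/and3P; split; rewrite // memE.
Qed.

(* As [1] is positive, truncated subtraction is harmless in the first case. *)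
Definition turning_point (t : nat) : Prop :=
  (3 < t /\ f3 t - f3 t.-1 > 1) \/
  (t = 3 /\ ~ is_least [pred m | (0 < m) && (m \notin [:: 1; 3])] (f3 3)).

Definition is_record (v : nat) : Prop :=
  exists t, turning_point t /\ v = f3 t.

(* Main.v *)
Require Import Defs.
From mathcomp Require Import all_boot.
From mathcomp Require Import zify.

(** The sequence has a simple shape. Suppose that [f3] has just filled an
    initial segment [{1, ..., u+1}] with [u] even and [f3 (u+1) = u]. The next
    value is the least [m > u+1] coprime with [u]; since [m - u] must be the
    least integer above 1 coprime with [u], this is [m = u + q], where [q] is
    the least prime not dividing [u]. After that jump the sequence goes through
    [u+2, u+3, ..., u+q-1] in order ([f3_block]), and the situation recurs with
    [u+q-1] in place of [u]. So everything about [f3] is encoded in the orbit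
    of 2 under [u |-> u + q - 1] (the predicate [pivot] below), and each
    pivot other than 2 is one less than a record.

    A pivot orbit cannot jump over certain numbers. It meets [p - 1] for every
    odd prime [p], as [p] itself is coprime with every smaller [u]
    ([pivot_pred_prime]). Write [P] for the [n]-th primorial and [p] for the
    next prime. Below [p P] the least prime not dividing a positive number
    is at most [p] ([lnp_le_nth_prime]), and whether it is smaller than [p],
    and which prime it then is, depends only on the residue modulo [P]. Since
    [u] and [r P - u] have the same prime divisors below [p], the orbit must
    meet [r P - 2], and then [r P] ([pivot_primorial]), which gives the records
    [r P - 1] and [r P + 1]. The steps also commute with translation by [P]
    ([lnp_shift]). Both [p - 1] and [P + (p - 1)] are pivots, the latter because
    the step out of [P] has length [p - 1]; hence the orbit beyond [p - 1] and
    its translate agree up to [p P], and this is the asserted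
    quasi-periodicity. *)

(** * The least prime not dividing a number *)

Lemma nondividing_prime_ex (u : nat) :
  exists p, prime p && ((0 < u) ==> ~~ (p %| u)).
Proof.
have [p lt_up p_pr] := prime_above u; exists p; rewrite p_pr /=.
by apply/implyP=> u_gt0; rewrite gtnNdvd.
Qed.

(** Every prime divides 0; there the side condition is dropped, and the value
    is 2. *)
Definition lnp (u : nat) : nat := ex_minn (nondividing_prime_ex u).

Lemma lnp_prime (u : nat) : prime (lnp u).
Proof. by rewrite /lnp; case: ex_minnP => p /andP[]. Qed.

Lemma lnp_ndvd (u : nat) : 0 < u -> ~~ (lnp u %| u).
Proof.
by move=> u_gt0; rewrite /lnp; case: ex_minnP => p /andP[_]; rewrite u_gt0.
Qed.

Lemma lnp_min (u s : nat) : prime s -> ~~ (s %| u) -> lnp u <= s.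
Proof.
move=> s_pr s_nu; rewrite /lnp; case: ex_minnP => p _; apply.
by rewrite s_pr s_nu implybT.
Qed.

Lemma dvdn_lt_lnp (u s : nat) : prime s -> s < lnp u -> s %| u.
Proof.
by move=> s_pr; apply: contraTT => /(lnp_min _ _ s_pr); rewrite -leqNgt.
Qed.

Lemma coprime_addl (u j : nat) : coprime (u + j) u = coprime j u.
Proof. by rewrite /coprime gcdnC gcdnDl gcdnC. Qed.

(** A prime factor of [j] is already a prime not dividing [u]. *)
Lemma lnp_le_coprime (u j : nat) : 1 < j -> coprime j u -> lnp u <= j.
Proof.
move=> j_gt1 co_ju; have pr_s := pdiv_prime j_gt1.
apply: leq_trans (lnp_min _ _ pr_s _) (pdiv_leq (ltnW j_gt1)).
by rewrite -prime_coprime //; apply: coprime_dvdl (pdiv_dvd j) co_ju.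
Qed.

Lemma lnp_even (u : nat) : 0 < u -> ~~ odd u -> 2 < lnp u /\ odd (lnp u).
Proof.
move=> u_gt0 ev_u; have q_pr := lnp_prime u.
have q_n2: lnp u != 2.
  by apply: contraNneq (lnp_ndvd _ u_gt0) => ->; rewrite dvdn2.
have q_gt2: 2 < lnp u by rewrite ltn_neqAle eq_sym q_n2 prime_gt1.
by split=> //; case: (even_prime q_pr) q_n2 => // ->.
Qed.

(** * The block structure of the sequence *)

(** If [{1, ..., u+1}] has been filled and [u] was the last value, then the
    next filled initial segment is [{1, ..., pivot_step u + 1}]. *)
Definition pivot_step (u : nat) : nat := u + (lnp u).-1.

Inductive pivot : nat -> Prop :=
| pivot2 : pivot 2
| pivotS (u : nat) : pivot u -> pivot (pivot_step u).

Lemma pivot_even (u : nat) : pivot u -> 0 < u /\ ~~ odd u.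
Proof.
elim=> // {}u _ [u_gt0 ev_u]; have [] := lnp_even _ u_gt0 ev_u.
by rewrite /pivot_step; lia.
Qed.

Lemma pivot_ge2 (u : nat) : pivot u -> 1 < u.
Proof. by case/pivot_even; lia. Qed.

Lemma lnp_pivot_gt2 (u : nat) : pivot u -> 2 < lnp u.
Proof. by case/pivot_even=> u_gt0 /(lnp_even _ u_gt0)[]. Qed.

(** The least value skipped by the jump to [u + lnp u] may follow that jump: a
    common prime factor would be less than [lnp u], hence divide [u] and so 2,
    but [lnp u] is odd. *)
Lemma coprime_after_jump (u : nat) :
  0 < u -> ~~ odd u -> coprime (u + 2) (u + lnp u).
Proof.
move=> u_gt0 ev_u; have [q_gt2 odd_q] := lnp_even _ u_gt0 ev_u.
set q := lnp u in q_gt2 odd_q *; rewrite /coprime; apply: contraT => g_n1.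
have g_gt1: 1 < gcdn (u + 2) (u + q).
  by rewrite ltn_neqAle eq_sym g_n1 gcdn_gt0 addn2.
have s_pr := pdiv_prime g_gt1; have := pdiv_dvd (gcdn (u + 2) (u + q)).
move: (pdiv _) s_pr => s s_pr; rewrite dvdn_gcd => /andP[s_u2 s_uq].
have s_q2: s %| q - 2 by rewrite -(subnDl u) dvdn_sub.
have s_u: s %| u.
  apply: dvdn_lt_lnp => //; apply: leq_ltn_trans (dvdn_leq _ s_q2) _.
    by rewrite subn_gt0.
  by rewrite ltn_subrL (ltn_trans _ q_gt2).
have s_2: s %| 2 by rewrite -(dvdn_addr _ s_u).
have s_eq2: s = 2 by apply/eqP; rewrite -dvdn_prime2.
by move: s_q2; rewrite s_eq2 dvdn2 oddB ?odd_q // ltnW.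
Qed.

Definition visited (k m : nat) : bool := m \in [seq f3 i | i <- iota 1 k].

Lemma visitedS (k m : nat) : visited k.+1 m = visited k m || (m == f3 k.+1).
Proof.
by rewrite /visited -(addn1 k) iotaD map_cat mem_cat /= inE add1n addn1.
Qed.

Lemma f3_eqP (k m : nat) : 1 < k ->
    [/\ 0 < m, ~~ visited k m & coprime m (f3 k)] ->
    (forall j, 0 < j -> ~~ visited k j -> coprime j (f3 k) -> m <= j) ->
  f3 k.+1 = m.
Proof.
move=> k_gt1 [m_gt0 m_new m_co] m_min.
have [/and3P[f_gt0 f_new f_co] f_min] := f3_rec (k_gt1 : 2 < k.+1).
apply/eqP; rewrite eqn_leq f_min ?m_min //.
by apply/and3P; split.
Qed.

(** The positions from [u+2] on, when [{1, ..., u+1}] has been filled and [u]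
    was the last value: the jump, and then the skipped values in order. *)
Lemma f3_fill (u : nat) :
    0 < u -> ~~ odd u ->
    (forall m, visited u.+1 m = (0 < m <= u.+1)) -> f3 u.+1 = u ->
  forall j, j < (lnp u).-1 ->
    (forall m, visited (u + 2 + j) m =
       (0 < m <= u.+1 + j) || (m == u + lnp u)) /\
    f3 (u + 2 + j) = if j is 0 then u + lnp u else u.+1 + j.
Proof.
move=> u_gt0 ev_u vis_u fu; have [q_gt2 odd_q] := lnp_even _ u_gt0 ev_u.
have q_co: coprime (lnp u) u by rewrite prime_coprime ?lnp_prime ?lnp_ndvd.
have next_co := coprime_after_jump _ u_gt0 ev_u.
elim=> [_|j IHj lt_j].
  have f_jump: f3 u.+2 = u + lnp u.
    apply: f3_eqP; first by rewrite ltnS.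
      by rewrite vis_u fu; split; [lia | lia | rewrite coprime_addl].
    move=> m m_gt0; rewrite vis_u fu => m_new m_co.
    have Dm : m = u + (m - u) by lia.
    rewrite Dm coprime_addl in m_co.
    rewrite Dm leq_add2l; apply: lnp_le_coprime m_co; lia.
  rewrite addn0 addn2; split=> // m.
  by rewrite visitedS vis_u f_jump addn0.
have [vis_j fj] := IHj (ltnW lt_j).
have f_next: f3 (u + 2 + j).+1 = u.+2 + j.
  apply: f3_eqP; first lia.
    split; [by [] | by rewrite vis_j; lia | rewrite fj].
    case: j {IHj lt_j vis_j fj} => [|j]; first by rewrite addn0 -addn2.
    by rewrite addSn; apply: coprimeSn.
  by move=> m m_gt0; rewrite vis_j; lia.
rewrite addnS f_next; split=> [m|]; last lia.
by rewrite visitedS vis_j f_next; lia.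
Qed.

Lemma pivot_filled (u : nat) : pivot u ->
  (forall m, visited u.+1 m = (0 < m <= u.+1)) /\ f3 u.+1 = u.
Proof.
elim=> [|{}u pu [vis_u fu]].
  have f3_3: f3 3 = 2.
    by apply: f3_eqP => // -[|[|m]].
  split=> // m; rewrite !visitedS f3_1 f3_2 f3_3 /visited /=; lia.
have [u_gt0 ev_u] := pivot_even _ pu; have q_gt2 := lnp_pivot_gt2 _ pu.
have [] := f3_fill _ u_gt0 ev_u vis_u fu (lnp u - 2); first lia.
have -> : u + 2 + (lnp u - 2) = (pivot_step u).+1 by rewrite /pivot_step; lia.
move=> vis_q fq; split=> [m|]; first by rewrite vis_q /pivot_step; lia.
by rewrite fq /pivot_step; case Dj: (lnp u - 2) => [|j]; lia.
Qed.

Lemma f3_pivot (u : nat) : pivot u -> f3 u.+1 = u.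
Proof. by case/pivot_filled. Qed.

Lemma f3_block (u k : nat) : pivot u -> u + 2 <= k <= (pivot_step u).+1 ->
  f3 k = if k == u + 2 then u + lnp u else k.-1.
Proof.
move=> pu k_in; have [u_gt0 ev_u] := pivot_even _ pu.
have [vis_u fu] := pivot_filled _ pu; have q_gt2 := lnp_pivot_gt2 _ pu.
have [] := f3_fill _ u_gt0 ev_u vis_u fu (k - (u + 2)).
  by move: k_in; rewrite /pivot_step; lia.
move=> _; rewrite subnKC; last by case/andP: k_in.
move->; case Dj: (k - (u + 2)) => [|j].
  by have -> : k == u + 2; lia.
by have -> : (k == u + 2) = false; lia.
Qed.

Lemma pivot_step_record (u : nat) : pivot u -> is_record (pivot_step u).+1.
Proof.
move=> pu; have q_gt2 := lnp_pivot_gt2 _ pu; have u_gt1 := pivot_ge2 _ pu.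
have f_jump: f3 u.+2 = u + lnp u.
  by rewrite -addn2 (f3_block u) ?eqxx //; rewrite /pivot_step; lia.
exists u.+2; split; last by rewrite f_jump /pivot_step; lia.
by left; rewrite f_jump f3_pivot //; lia.
Qed.

Lemma pivot_record (u : nat) : pivot u -> 2 < u -> is_record u.+1.
Proof. by case=> // {}u pu _; apply: pivot_step_record. Qed.

(** * Numbers that the pivots cannot jump over *)

Lemma pivot_hits (a T : nat) : pivot a -> a <= T ->
    (forall u, pivot u -> u < T -> pivot_step u <= T) ->
  pivot T.
Proof.
move=> pa le_aT no_jump.
have [d] := ubnP (T - a); elim: d => // d IHd in a pa le_aT *.
move=> lt_d; move: le_aT; rewrite leq_eqVlt => /orP[/eqP <- // | lt_aT].
apply: IHd (pivotS _ pa) (no_jump _ pa lt_aT) _.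
by have := lnp_pivot_gt2 _ pa; rewrite /pivot_step; lia.
Qed.

(** A prime [p] is coprime with every smaller [u], so the jump from [u] does
    not go beyond [p]. *)
Lemma pivot_pred_prime (p : nat) : prime p -> 2 < p -> pivot p.-1.
Proof.
move=> p_pr p_gt2; apply: (pivot_hits 2); [exact: pivot2 | lia |].
move=> u pu lt_up; have u_gt1 := pivot_ge2 _ pu.
have: lnp u <= p - u.
  apply: lnp_le_coprime; first lia.
  rewrite -coprime_addl subnKC; last lia.
  by rewrite prime_coprime // gtnNdvd //; lia.
by rewrite /pivot_step; lia.
Qed.

(** * Primorials *)

Lemma nth_prime_prime (n : nat) : prime (nth_prime n.+1).
Proof.
rewrite -[nth_prime _]/(next_prime (nth_prime n)) /next_prime.
by case: ex_minnP => p /andP[].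
Qed.

Lemma nth_primeS_lt (n s : nat) :
  prime s -> (nth_prime n < s) = (nth_prime n.+1 <= s).
Proof.
move=> s_pr; rewrite -[nth_prime n.+1]/(next_prime (nth_prime n)) /next_prime.
case: ex_minnP => p /andP[lt_np _] p_min.
by apply/idP/idP=> [lt_ns|]; [apply: p_min; rewrite lt_ns | apply: leq_trans].
Qed.

Lemma nth_prime_gt (n : nat) : n.+1 < nth_prime n.+1.
Proof.
elim: n => [|n IHn]; first by rewrite prime_gt1 ?nth_prime_prime.
by apply: leq_ltn_trans IHn _; rewrite nth_primeS_lt ?nth_prime_prime.
Qed.

Lemma primorialS (n : nat) : primorial n.+1 = primorial n * nth_prime n.+1.
Proof. by rewrite /primorial big_nat_recr. Qed.

Lemma prime_dvd_primorial (n s : nat) :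
  prime s -> (s %| primorial n) = (s < nth_prime n.+1).
Proof.
move=> s_pr; elim: n => [|n IHn].
  rewrite /primorial big_geq // ltnNge -nth_primeS_lt // prime_gt0 //=.
  by rewrite dvdn1; case: s s_pr => [|[]].
rewrite primorialS Euclid_dvdM // IHn dvdn_prime2 ?nth_prime_prime //.
by rewrite [RHS]ltnNge -nth_primeS_lt // -leqNgt [RHS]leq_eqVlt orbC.
Qed.

Lemma primorial_gt0 (n : nat) : 0 < primorial n.
Proof.
elim: n => [|n IHn]; first by rewrite /primorial big_geq.
by rewrite primorialS muln_gt0 IHn prime_gt0 ?nth_prime_prime.
Qed.

Lemma primorial_dvdn (n u : nat) :
    (forall s, prime s -> s < nth_prime n.+1 -> s %| u) ->
  primorial n %| u.
Proof.
elim: n => [|n IHn] dvd_u; first by rewrite /primorial big_geq // dvd1n.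
have p_pr := nth_prime_prime n; have lt_p: nth_prime n.+1 < nth_prime n.+2.
  by rewrite nth_primeS_lt ?nth_prime_prime.
rewrite primorialS Gauss_dvd; last first.
  by rewrite coprime_sym prime_coprime // prime_dvd_primorial // ltnn.
rewrite (dvd_u _ p_pr lt_p) andbT; apply: IHn => s s_pr lt_sp.
by apply: dvd_u => //; apply: ltn_trans lt_p.
Qed.

Lemma leq_shift_primorial (n k : nat) :
  (k <= (nth_prime n.+1 - 1) * primorial n) =
  (k + primorial n <= primorial n.+1).
Proof.
have p_gt0 := prime_gt0 (nth_prime_prime n).
by rewrite primorialS mulnC -{2}(subnK p_gt0) mulnDr muln1 leq_add2r.
Qed.

(** A positive number divisible by the first [n+1] primes is at least their
    product. *)
Lemma lnp_le_nth_prime (n u : nat) :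
  0 < u < primorial n.+1 -> lnp u <= nth_prime n.+1.
Proof.
case/andP=> u_gt0 lt_u; rewrite leqNgt nth_primeS_lt ?lnp_prime //.
apply: contraTN lt_u => le_q; rewrite -leqNgt; apply: dvdn_leq => //.
apply: primorial_dvdn => s s_pr lt_s.
by apply: dvdn_lt_lnp => //; apply: leq_trans lt_s le_q.
Qed.

Lemma lnp_primorial (n : nat) : lnp (primorial n) = nth_prime n.+1.
Proof.
apply/eqP; rewrite eqn_leq lnp_min ?nth_prime_prime //=; last first.
  by rewrite prime_dvd_primorial ?nth_prime_prime ?ltnn.
rewrite leqNgt -prime_dvd_primorial ?lnp_prime //.
exact: lnp_ndvd (primorial_gt0 n).
Qed.

(** Both values are at most the next prime, and the smaller primes, which
    divide [primorial n], do not distinguish [u] from [u + primorial n]. *)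
Lemma lnp_shift (n u : nat) :
  0 < u -> u + primorial n < primorial n.+1 -> lnp (u + primorial n) = lnp u.
Proof.
move=> u_gt0 lt_uP.
have le_v: lnp (u + primorial n) <= nth_prime n.+1.
  by apply: lnp_le_nth_prime; rewrite addn_gt0 u_gt0.
have le_u: lnp u <= nth_prime n.+1.
  apply: lnp_le_nth_prime; rewrite u_gt0.
  exact: leq_ltn_trans (leq_addr _ _) lt_uP.
have dvd_shift s : prime s -> s < nth_prime n.+1 ->
    (s %| u + primorial n) = (s %| u).
  by move=> s_pr; rewrite -prime_dvd_primorial // => s_P; rewrite dvdn_addl.
apply/eqP; rewrite eqn_leq; apply/andP; split.
  have [lt_q | ] := ltnP (lnp u) (nth_prime n.+1); last exact: leq_trans.
  by apply: lnp_min; rewrite ?dvd_shift ?lnp_prime ?lnp_ndvd.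
have [lt_q | le_q] := ltnP (lnp (u + primorial n)) (nth_prime n.+1).
  by apply: lnp_min; rewrite -?dvd_shift ?lnp_prime ?lnp_ndvd ?addn_gt0 ?u_gt0.
exact: leq_trans le_q.
Qed.

Lemma primorial_dvd23 (n : nat) :
  2 <= n -> (2 %| primorial n) && (3 %| primorial n).
Proof.
move=> n_ge2; have lt_np := nth_prime_gt n.
by rewrite !prime_dvd_primorial //; lia.
Qed.

(** The jump from [u] must not exceed [w - 1], where [w = r P - u] is the
    distance to [r P]. A prime factor of [w - 1] that divides [P] does not
    divide [w], hence does not divide [u]; a prime factor that does not divide
    [P] is at least the next prime, which bounds [lnp u]. Finally 3 divides
    [r P] but not [r P - 2], so the step from [r P - 2] leads to [r P]. *)
Lemma pivot_primorial (n r : nat) : 2 <= n -> 0 < r < nth_prime n.+1 ->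
  pivot (r * primorial n - 2) /\ pivot (r * primorial n).
Proof.
move=> n_ge2 /andP[r_gt0 lt_rp].
have /andP[dvd2 dvd3] := primorial_dvd23 _ n_ge2.
have P_gt0 := primorial_gt0 n.
have N_bound: r * primorial n <= primorial n.+1.
  by rewrite primorialS mulnC leq_mul2l (ltnW lt_rp) orbT.
have N_dvd s : s %| primorial n -> s %| r * primorial n by apply: dvdn_mull.
have N_gt0: 0 < r * primorial n by rewrite muln_gt0 r_gt0.
move: (r * primorial n) N_bound N_dvd N_gt0 => N N_bound N_dvd N_gt0.
move/N_dvd: dvd2; move/N_dvd: dvd3 => dvd3 dvd2; have N_ge6: 6 <= N by lia.
have pN2: pivot (N - 2).
  apply: (pivot_hits 2); [exact: pivot2 | lia | move=> u pu lt_u].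
  suff: lnp u <= N - u - 1 by rewrite /pivot_step; lia.
  have u_gt1 := pivot_ge2 _ pu.
  have w1_gt1: 1 < N - u - 1 by lia.
  have s_pr := pdiv_prime w1_gt1; have s_dvd := pdiv_dvd (N - u - 1).
  apply: leq_trans (pdiv_leq (ltnW w1_gt1)).
  move: (pdiv _) s_pr s_dvd => s s_pr s_dvd.
  have [lt_sp | le_ps] := ltnP s (nth_prime n.+1).
    apply: lnp_min => //; apply/negP=> s_u.
    have s_N: s %| N by rewrite N_dvd // prime_dvd_primorial.
    have s_w: s %| N - u by rewrite dvdn_sub.
    have: s %| N - u - (N - u - 1) by rewrite dvdn_sub.
    rewrite subKn; last lia.
    by rewrite dvdn1; apply/negP; rewrite neq_ltn prime_gt1 ?orbT.
  by apply: leq_trans le_ps; apply: lnp_le_nth_prime; lia.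
split=> //; have := pivotS _ pN2; rewrite /pivot_step.
have -> : lnp (N - 2) = 3.
  apply/eqP; rewrite eqn_leq lnp_pivot_gt2 // andbT lnp_min //.
  by lia.
by rewrite subnK; last lia.
Qed.

(** * Quasi-periodicity *)

(** The position [p + 1] starts the block of the pivot [p - 1], whose translate
    [P + (p - 1)] is where the step out of the pivot [P] arrives. From there on
    the two orbits advance in parallel by [lnp_shift]. *)
Lemma pivot_block_shift (n k : nat) : 2 <= n ->
    nth_prime n.+1 < k -> k + primorial n <= primorial n.+1 ->
  exists u, [/\ pivot u, pivot (u + primorial n)
              & u + 2 <= k <= (pivot_step u).+1].
Proof.
move=> n_ge2 lt_pk le_k; have lt_np := nth_prime_gt n.
have p_pr := nth_prime_prime n; have p_gt0 := prime_gt0 p_pr.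
elim: k lt_pk le_k => // k IHk; rewrite ltnS leq_eqVlt.
case/orP=> [/eqP Dk _ | lt_pk le_k].
  have p_gt2 : 2 < nth_prime n.+1 by lia.
  have pp := pivot_pred_prime _ p_pr p_gt2.
  have q_gt2 := lnp_pivot_gt2 _ pp.
  exists (nth_prime n.+1).-1; split=> //; last by rewrite /pivot_step; lia.
  have [|_] := pivot_primorial n 1 n_ge2; first exact: prime_gt1.
  by rewrite mul1n => /pivotS; rewrite /pivot_step lnp_primorial addnC.
have [u [pu puP /andP[le_uk le_ku]]] := IHk lt_pk (ltnW le_k).
have u_gt1 := pivot_ge2 _ pu.
have [le_k1 | lt_k1] := leqP k.+1 (pivot_step u).+1.
  by exists u; split; rewrite // le_k1 andbT; lia.
have q_gt2 := lnp_pivot_gt2 _ (pivotS _ pu).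
exists (pivot_step u); split; first exact: pivotS.
  have lt_uP: u + primorial n < primorial n.+1.
    by apply: leq_trans le_k; rewrite ltn_add2r; lia.
  rewrite /pivot_step addnAC -(lnp_shift _ _ (ltnW u_gt1) lt_uP).
  exact: pivotS.
apply/andP; split; first lia.
by rewrite {1}/pivot_step; lia.
Qed.

Theorem theorem2p9 (n : nat) (hn : 2 <= n) :
  (forall r, 1 <= r <= nth_prime n.+1 - 1 ->
     is_record (r * primorial n - 1) /\ is_record (r * primorial n + 1)) /\
  (forall k, nth_prime n.+1 <= k <= (nth_prime n.+1 - 1) * primorial n ->
     f3 (k + primorial n) = f3 k + primorial n).
Proof.
have p_pr := nth_prime_prime n; have p_gt1 := prime_gt1 p_pr.
have lt_np := nth_prime_gt n; have P_gt0 := primorial_gt0 n.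
have /andP[dvd2 dvd3] := primorial_dvd23 _ hn.
split=> [r r_in | k /andP[]].
  have [|pN2 pN] := pivot_primorial n r hn; first lia.
  have le_PN: primorial n <= r * primorial n by rewrite leq_pmull; lia.
  split; last by rewrite addn1; apply: pivot_record => //; lia.
  have -> : r * primorial n - 1 = (r * primorial n - 2).+1 by lia.
  by apply: pivot_record => //; lia.
rewrite leq_eqVlt leq_shift_primorial => /orP[/eqP <- _ | lt_pk le_kP].
  (* The position [p] ends the block of the pivot preceding [p - 1], and its
     translate lies inside the block of the pivot [P]. *)
  have p_gt3: 3 < nth_prime n.+1 by lia.
  have [|_] := pivot_primorial n 1 hn; first lia.
  rewrite mul1n => pP.
  rewrite (f3_block _ _ pP) ?/pivot_step ?lnp_primorial; last lia.
  have -> : (nth_prime n.+1 + primorial n == primorial n + 2) = false by lia.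
  have := f3_pivot _ (pivot_pred_prime _ p_pr (ltnW p_gt3)).
  by rewrite prednK; lia.
have [u [pu puP k_in]] := pivot_block_shift n k hn lt_pk le_kP.
have u_gt1 := pivot_ge2 _ pu.
have q_shift: lnp (u + primorial n) = lnp u.
  apply: lnp_shift; first exact: ltnW u_gt1.
  by apply: leq_trans le_kP; rewrite ltn_add2r; lia.
rewrite (f3_block _ _ pu k_in) (f3_block _ _ puP); last first.
  by move: k_in; rewrite /pivot_step q_shift; lia.
by rewrite q_shift addnAC eqn_add2r; case: ifP => _; lia.
Qed.
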